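(* If $k$ is an odd prime, then $$S(k)\ge -\frac{k-1}{2}+kH(k)-\frac{(k-1)(k+1)}{4},$$ where, as $k\to\infty$, $$H(k)=\frac12\log(2k)+\frac{\gamma}{2}+O\left(\frac1k\right),$$ and $\gamma$ denotes Euler's constant.
   Context: For positive integers $h,k$, $S(h,k)=\sum_{j=1}^{k-1}(-1)^{j+1+[hj/k]}$, where $[x]$ is the greatest integer less than or equal to $x$, and $S(k)=\sum_{h=1}^{k-1}S(h,k)$. Also $H(k)=\sum_{1\le j\le k-1,\ j\text{ odd}}\frac1j$. *)

(* Defs.v *)
From HB Require Import structures.
From mathcomp Require Import all_boot all_order all_algebra.
From mathcomp Require Import all_classical all_reals all_analysis.

Set Implicit Arguments.
Unset Strict Implicit.
Unset Printing Implicit Defensive.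

Import Order.TTheory GRing.Theory Num.Theory.
Import numFieldNormedType.Exports.

Local Open Scope ring_scope.

                                                                          
Definition hardy_sum (h k : nat) : int :=
  \sum_(1 <= j < k) (-1) ^+ (j + 1 + (h * j) %/ k)%N.

Definition hardy_total (k : nat) : int :=
  \sum_(1 <= h < k) hardy_sum h k.

Definition odd_harmonic (R : realType) (k : nat) : R :=
  \sum_(1 <= j < k | odd j) j%:R^-1.

                                                 
Definition euler_gamma (R : realType) : R :=
  limn (fun n : nat => series (@harmonic R) n - ln n%:R).

(* Main.v *)
Require Import Defs.
From HB Require Import structures.
From mathcomp Require Import all_boot all_order all_algebra.
From mathcomp Require Import all_classical all_reals all_analysis.
From mathcomp Require Import zify lra.

Import Order.TTheory GRing.Theory Num.Theory.
Import numFieldNormedType.Exports.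

Local Open Scope classical_set_scope.
Local Open Scope ring_scope.

(** The inequality holds term by term after exchanging the two summations.  In
the double sum defining S(k), the inner sum over h for fixed j is
(-1)^(j+1) T_j, with T_j the sum over 1 <= h < k of (-1)^[hj/k].  For even j
the involution h -> k - h sends [hj/k] to j - 1 - [hj/k], because k is prime
and so divides no hj; it reverses every sign and T_j = 0
([floor_sign_sum_even]).  Hence S(k) is the sum of T_j over odd j < k.

For odd j, let W(x) be the distance from x to the nearest even integer: a
triangle wave of slope (-1)^[x].  Along the points hj/k the signs (-1)^[hj/k]
times the step j/k therefore telescope to W(j) - W(0) = 1, up to an error at
each step that crosses an integer.  These signs run over 0 <= h < k and add up
to T_j + 1.  Crossing an odd integer errs in the
favourable direction; crossing an even one costs at most 2j/k, and there are
(j-1)/2 of these.  So j (T_j + 1) >= k - j (j-1), that is T_j >= k/j - j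
([floor_sign_sum_odd]).  Summing over the odd j < k gives kH(k) - ((k-1)/2)^2,
which is larger than the stated bound.

For the asymptotics, write h_n for the n-th harmonic number.  If n = [k/2], the
odd numbers below k are 1, 3, ..., 2n-1, so H(k) = h_(2n) - h_n / 2
([odd_harmonicE]).  The sequences h_n - ln n and h_n - ln n - 1/n are monotone
in opposite directions and enclose gamma, so 0 <= h_n - ln n - gamma <= 1/n
([harmonic_gamma_bounds]).  Then H(k) = ln(4n)/2 + gamma/2 + O(1/n), and
replacing 4n by 2k, at most 4n + 2, changes the logarithm by O(1/n). *)

(** * Sums over odd indices *)

Lemma sum_odd_nat (V : nmodType) (F : nat -> V) (k : nat) :
  \sum_(1 <= j < k | odd j) F j = \sum_(0 <= i < k./2) F (i.*2.+1).
Proof.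
case: k => [|k]; first by rewrite !big_geq.
elim: k => [|k IHk]; first by rewrite !big_geq.
rewrite big_mkcond big_nat_recr //= -big_mkcond IHk /= uphalf_half.
have := odd_double_half k; case: (odd k) => /= kE; rewrite ?add0n ?addr0 //.
by rewrite [RHS]big_nat_recr //=; congr (_ + F _); lia.
Qed.

Lemma sum_odd_numbers (R : pzSemiRingType) (n : nat) :
  \sum_(0 <= i < n) (i.*2.+1)%:R = n%:R ^+ 2 :> R.
Proof.
elim: n => [|n IHn]; first by rewrite big_geq // expr2 mul0r.
rewrite big_nat_recr //= IHn -!natrX -natrD; congr _%:R.
by rewrite -!mulnn; nia.
Qed.

(** * The lower bound *)

Definition floor_sign_sum (k j : nat) : int :=
  \sum_(1 <= h < k) (-1) ^+ ((h * j) %/ k)%N.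

(** Pairing h with k - h.  Coprimality makes hj/k a non-integer, so that the two
floors add up to j - 1 and have opposite parities. *)
Lemma floor_sign_sum_even (k j : nat) :
  coprime k j -> ~~ odd j -> floor_sign_sum k j = 0.
Proof.
move=> cokj oj; suff: floor_sign_sum k j = - floor_sign_sum k j by lia.
rewrite {1}/floor_sign_sum big_nat_rev /= -sumrN !big_nat.
apply: eq_bigr => h /andP[h0 hk].
have hjk : (0 < (h * j) %% k)%N.
  rewrite lt0n; apply/negP; rewrite -/(k %| h * j)%N Gauss_dvdl //.
  by move=> /(dvdn_leq h0); rewrite leqNgt hk.
have k0 : (0 < k)%N by lia.
have j0 : (0 < j)%N by case: (j) hjk; rewrite ?muln0 ?mod0n.
have qj : ((h * j) %/ k < j)%N.
  by rewrite ltn_divLR // [ltnRHS]mulnC ltn_pmul2r.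
suff -> : (((1 + k - h.+1) * j) %/ k = j - 1 - (h * j) %/ k)%N.
  rewrite -signr_odd -[in RHS]signr_odd oddB; last by lia.
  rewrite oddB; last by lia.
  by rewrite (negbTE oj); case: (odd (_ %/ _)).
have rk : ((h * j) %% k < k)%N by rewrite ltn_mod.
move: (divn_eq (h * j) k) qj hjk rk; set q := (_ %/ _)%N; set r := (_ %% _)%N.
move=> E qj r0 rk.
have -> : ((1 + k - h.+1) * j = (j - 1 - q) * k + (k - r))%N by nia.
by rewrite divnMDl // divn_small ?addn0 //; lia.
Qed.

(** The triangle wave [W], scaled by [k] and evaluated at [n * j / k], is [r] or
[k - r] according to the parity of the floor, [r] being the remainder.  The
number of even positive integers crossed so far is half the floor. *)
Lemma floor_sign_partial_sum (k j n : nat) : (0 < k)%N -> (j <= k)%N ->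
  let q := ((n * j) %/ k)%N in let r := ((n * j) %% k)%N in
  ((if odd q then k - r else r)%N : int) - ((j * q./2).*2)%:Z <=
    j%:Z * \sum_(0 <= h < n) (-1) ^+ ((h * j) %/ k)%N.
Proof.
move=> k0 jk; elim: n => [|n IHn] /=.
  by rewrite mul0n div0n mod0n big_geq //= muln0 mulr0.
move: IHn; rewrite big_nat_recr //= mulrDr mulSnr.
have rk : ((n * j) %% k < k)%N by rewrite ltn_mod.
move: (divn_eq (n * j) k) rk.
set S := \sum_(0 <= h < n) _.
set q := ((n * j) %/ k)%N; set r := ((n * j) %% k)%N => E rk.
have sq : (-1) ^+ q = (if odd q then -1 else 1) :> int.
  by rewrite -signr_odd; case: (odd q).
rewrite sq; move: (j%:Z * S) => jS; change int in (type of jS).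
have [rjk|krj] := ltnP (r + j) k.
  have Q : ((n * j + j) %/ k = q)%N by rewrite E -addnA divnMDl // divn_small ?addn0.
  have M : ((n * j + j) %% k = r + j)%N by rewrite E -addnA modnMDl modn_small.
  by rewrite Q M; case: ifP => _; lia.
have E' : (n * j + j = q.+1 * k + (r + j - k))%N by rewrite E mulSn; lia.
have Q : ((n * j + j) %/ k = q.+1)%N.
  by rewrite E' divnMDl // divn_small ?addn0 //; lia.
have M : ((n * j + j) %% k = r + j - k)%N.
  by rewrite E' modnMDl modn_small //; lia.
rewrite Q M /= uphalf_half mulnDr.
move: (j * q./2)%N => p; clearbody r.
by case: (odd q); rewrite ?muln1 ?muln0 ?mulrN1 ?mulr1 => /=; lia.
Qed.

(** The partial sum at n = k, where the wave is at the odd integer j and so has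
height k; the term h = 0 is then removed from the sum. *)
Lemma floor_sign_sum_odd (k j : nat) : (0 < k)%N -> (j <= k)%N -> odd j ->
  k%:Z - (j * j)%:Z <= j%:Z * floor_sign_sum k j.
Proof.
move=> k0 jk oj; have := @floor_sign_partial_sum k j k k0 jk.
rewrite /= mulKn // modnMr oj subn0 big_ltn // mul0n div0n expr0 mulrDr mulr1.
rewrite -/(floor_sign_sum k j); set jT := j%:Z * floor_sign_sum k j.
have -> : ((j * j./2).*2 = j * j - j)%N.
  have := odd_double_half j; rewrite oj => J; rewrite doubleMr; nia.
have : (j <= j * j)%N by rewrite leq_pmulr //; lia.
by lia.
Qed.

Lemma hardy_totalE (k : nat) : prime k ->
  hardy_total k = \sum_(1 <= j < k | odd j) floor_sign_sum k j.
Proof.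
move=> pk; rewrite /hardy_total /hardy_sum exchange_big /= [RHS]big_mkcond /=.
rewrite !big_nat; apply: eq_bigr => j /andP[j0 jk].
under eq_bigr do rewrite exprD.
rewrite -mulr_sumr -/(floor_sign_sum k j) addn1 -signr_odd /=.
case: ifPn => oj; first by rewrite expr0 mul1r.
rewrite (@floor_sign_sum_even k j) ?mulr0 // prime_coprime //.
by apply/negP => /(dvdn_leq j0); rewrite leqNgt jk.
Qed.

Lemma hardy_total_lower_bound (R : realFieldType) (k : nat) :
  prime k -> odd k ->
  k%:R * (\sum_(1 <= j < k | odd j) j%:R^-1) - ((k%:R - 1) / 2) ^+ 2
    <= (hardy_total k)%:~R :> R.
Proof.
move=> pk ok; rewrite hardy_totalE // rmorph_sum /=.
have -> : ((k%:R - 1) / 2) ^+ 2 = \sum_(1 <= j < k | odd j) j%:R :> R.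
  rewrite sum_odd_nat sum_odd_numbers; congr (_ ^+ 2).
  have -> : k%:R = 1 + 2 * (k./2)%:R :> R.
    by rewrite -{1}[k]odd_double_half ok -muln2 natrD natrM mulrC.
  by lra.
rewrite mulr_sumr -sumrB [leLHS]big_nat_cond [leRHS]big_nat_cond.
apply: ler_sum => j /andP[/andP[j0 jk] oj].
have j0R : 0 < j%:R :> R by rewrite ltr0n.
have := @floor_sign_sum_odd k j (prime_gt0 pk) (ltnW jk) oj.
rewrite -(ler_int R) rmorphB intrM /= -!pmulrn natrM => T.
rewrite -(ler_pM2l j0R); apply: le_trans T.
by rewrite mulrBr mulrCA mulfV ?gt_eqF // mulr1.
Qed.

(** * The harmonic sum and Euler's constant *)

Lemma ln_diff_le (R : realType) (x y : R) : 0 < x -> 0 < y ->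
  ln y - ln x <= (y - x) / x.
Proof.
move=> x0 y0; rewrite -ln_div ?posrE //.
have -> : y / x = 1 + (y - x) / x by rewrite mulrBl divff ?gt_eqF // addrC subrK.
apply: le_ln1Dx; rewrite mulrBl divff ?gt_eqF //.
by have : 0 < y / x by [exact: divr_gt0]; lra.
Qed.

Lemma seriesS_harmonic (R : realType) (n : nat) :
  series (@harmonic R) n.+1 = series (@harmonic R) n + n.+1%:R^-1.
Proof. by rewrite /series /= big_nat_recr. Qed.

Lemma ln_natS_bounds (R : realType) (n : nat) :
  n.+2%:R^-1 <= ln (n.+2%:R : R) - ln n.+1%:R <= n.+1%:R^-1.
Proof.
have x0 : 0 < n.+1%:R :> R by rewrite ltr0n.
have y0 : 0 < n.+2%:R :> R by rewrite ltr0n.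
have D : n.+2%:R - n.+1%:R = 1 :> R by rewrite mulrSr addrAC subrr add0r.
apply/andP; split; last by have := ln_diff_le _ _ _ x0 y0; rewrite D mul1r.
have := ln_diff_le _ _ _ y0 x0; rewrite -[n.+1%:R - _]opprB D mulN1r.
by rewrite lerNr opprB.
Qed.

(** By [ln_natS_bounds], h_n - ln n decreases and h_n - ln n - 1/n increases.
Each bounds the other, so both converge, to the same limit gamma, which
therefore lies between them for every n. *)
Lemma harmonic_gamma_bounds (R : realType) (n : nat) : (0 < n)%N ->
  0 <= series (@harmonic R) n - ln n%:R - euler_gamma R <= n%:R^-1.
Proof.
case: n => // n _.
pose u : R^nat := fun m => series (@harmonic R) m - ln m%:R.
(* the shift matters: as ln 0 = 0, u increases from u 0 = 0 to u 1 = 1 *)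
pose a : R^nat := fun m => u m.+1.
pose b : R^nat := fun m => u m.+1 - m.+1%:R^-1.
have a_dec : nonincreasing_seq a.
  apply/nonincreasing_seqP => m; rewrite /a /u seriesS_harmonic.
  by have /andP[] := ln_natS_bounds R m; move: m.+1%:R m.+2%:R => x y; lra.
have b_inc : nondecreasing_seq b.
  apply/nondecreasing_seqP => m; rewrite /b /u (seriesS_harmonic R m.+1).
  by have /andP[] := ln_natS_bounds R m; move: m.+1%:R m.+2%:R => x y; lra.
have ba m p : b m <= a p.
  have ba_diag i : b i <= a i by rewrite lerBlDr lerDl invr_ge0.
  apply: le_trans (b_inc _ _ (leq_maxl m p)) _.
  by apply: le_trans (ba_diag _) (a_dec _ _ (leq_maxr m p)).
have a_cvg : cvgn a.
  apply: nonincreasing_is_cvgn => //.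
  by exists (b 0) => _ [m _ <-]; exact: ba.
have gammaE : limn a = euler_gamma R.
  rewrite /euler_gamma -/u; apply/esym/cvg_lim => //.
  by rewrite -(cvg_shiftS u); exact: a_cvg.
have := nonincreasing_cvgn_ge a_dec a_cvg n.
have : b n <= limn a by apply: limr_ge => //; near=> m; exact: ba.
by rewrite gammaE /b /a /u; move: n.+1%:R => x ? ?; apply/andP; split; lra.
Unshelve. all: by end_near.
Qed.

(** The odd reciprocals are all reciprocals up to 2n, minus the even ones, which
make up half of the harmonic sum up to n. *)
Lemma odd_harmonicE (R : realType) (k : nat) :
  odd_harmonic R k =
    series (@harmonic R) k./2.*2 - series (@harmonic R) k./2 / 2.
Proof.
rewrite /odd_harmonic sum_odd_nat.
elim: (k./2) => [|n IHn]; first by rewrite /series /= !big_geq // mul0r subr0.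
rewrite big_nat_recr //= IHn doubleS !seriesS_harmonic.
have -> : (n.*2.+2)%:R^-1 = n.+1%:R^-1 / 2 :> R.
  by rewrite -doubleS -muln2 natrM invfM.
by move: n.+1%:R n.*2.+1%:R => x y; lra.
Qed.

(** With n = [k/2] the errors are at most 1/(2n) from the harmonic numbers and
1/(4n) from the logarithm.  Since k <= 3n, their sum is below 3/k. *)
Lemma odd_harmonic_approx (R : realType) (k : nat) : (1 < k)%N ->
  `|odd_harmonic R k - (2^-1 * ln (2 * k%:R) + euler_gamma R / 2)|
    <= 3 * k%:R^-1.
Proof.
move=> k1; rewrite odd_harmonicE; set n := k./2.
have n0 : (0 < n)%N by rewrite /n; lia.
have n0R : 0 < n%:R :> R by rewrite ltr0n.
have k0R : 0 < k%:R :> R by rewrite ltr0n; lia.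
have n20R : 0 < 2 * n%:R :> R by rewrite mulr_gt0.
have /andP[D1l D1u] := harmonic_gamma_bounds R _ n0.
have n20 : (0 < n.*2)%N by rewrite double_gt0.
have /andP[D2l D2u] := harmonic_gamma_bounds R _ n20.
have n2E : n.*2%:R = 2 * n%:R :> R by rewrite -mul2n natrM.
rewrite n2E lnM ?posrE // in D2l D2u.
rewrite invfM in D2u.
have nk : 2 * n%:R <= k%:R :> R by rewrite -natrM ler_nat /n; lia.
have kn : k%:R - 2 * n%:R <= 1 :> R.
  by rewrite lerBlDr -natrM nat1r ler_nat /n; lia.
have k3n : k%:R <= 3 * n%:R :> R by rewrite -natrM ler_nat /n; lia.
(* replacing 2k by 4n under the logarithm *)
have Ll : ln (2 * n%:R) <= ln k%:R :> R by rewrite ler_ln ?posrE.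
have Lu : ln k%:R - ln (2 * n%:R) <= 2^-1 * n%:R^-1 :> R.
  apply: le_trans (ln_diff_le _ _ _ n20R k0R) _.
  by rewrite -invfM ler_pdivrMr // mulVf ?gt_eqF.
rewrite lnM ?posrE // in Ll Lu.
rewrite lnM ?posrE //.
have nV : n%:R^-1 <= 3 * k%:R^-1 :> R.
  rewrite -[3 * _]invrK lef_pV2 ?posrE ?invr_gt0 ?mulr_gt0 ?invr_gt0 //.
  by rewrite invfM invrK; lra.
have nV0 : 0 < n%:R^-1 :> R by rewrite invr_gt0.
by rewrite ler_norml; apply/andP; split; lra.
Qed.

Theorem theorem6p3 (R : realType) :
  (forall k : nat, prime k -> odd k ->
     (hardy_total k)%:~R >=
       - ((k%:R - 1) / 2) + k%:R * odd_harmonic R k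
       - (k%:R - 1) * (k%:R + 1) / 4 :> R) /\
  (odd_harmonic R : nat -> R) =
    (fun k : nat => 2^-1 * ln (2 * k%:R) + euler_gamma R / 2 : R)
      +O_\oo (fun k : nat => k%:R^-1 : R).
Proof.
split=> [k pk ok|].
  apply: le_trans (@hardy_total_lower_bound R k pk ok).
  have k1 : 1 <= k%:R :> R by rewrite ler1n prime_gt0.
  by rewrite -/(odd_harmonic R k) expr2; nra.
apply/eqaddOP/bigO_exP; exists 3; first exact: ltr0n.
near=> k; rewrite [`|k%:R^-1|]ger0_norm ?invr_ge0 //.
by apply: odd_harmonic_approx; near: k; exact: nbhs_infty_gt.
Unshelve. all: by end_near.
Qed.
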